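(* Let $C_4$ be the cycle on $4$ vertices. The set of all ordered multiplicity lists attained by matrices in $\mathcal{S}_L(C_4)$ is exactly $\{(1,1,1,1), (1,2,1)\}$.
   Context: For a finite simple graph $G$ on $n$ vertices, $\mathcal{S}_L(G)$ denotes the set of $n\times n$ real symmetric matrices $A=[a_{i,j}]$ such that $a_{i,j}<0$ if $\{i,j\}\in E(G)$, $a_{i,j}=0$ if $i\neq j$ and $\{i,j\}\notin E(G)$, and $a_{i,i}=-\sum_{k\neq i}a_{i,k}$ for all $i$. The ordered multiplicity list of $A\in\mathcal{S}_L(G)$ is $(m_1,\ldots,m_q)$, where $\lambda_1<\lambda_2<\cdots<\lambda_q$ are the distinct eigenvalues of $A$ in increasing order and $m_i$ is the multiplicity of $\lambda_i$. *)

(* Defs.v *)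
From HB Require Import structures.
From mathcomp Require Import all_boot all_order all_algebra.
From mathcomp Require Import classical_sets reals.

Set Implicit Arguments.
Unset Strict Implicit.
Unset Printing Implicit Defensive.

Import Order.TTheory GRing.Theory Num.Theory.
Local Open Scope ring_scope.

Record sgraph (n : nat) := SGraph {
  adj :> rel 'I_n;
  adj_sym : symmetric adj;
  adj_irr : irreflexive adj
}.

(* [ordS] is the successor modulo [n]. For [2 < n] the conjunct [i != j] is
   redundant; it only keeps the degenerate cases [n <= 1] loopless. *)
Definition cycle_rel (n : nat) : rel 'I_n :=
  fun i j => (i != j) && ((j == ordS i) || (i == ordS j)).

Lemma cycle_rel_sym (n : nat) : symmetric (@cycle_rel n).
Proof. by move=> i j; rewrite /cycle_rel eq_sym orbC. Qed.

Lemma cycle_rel_irr (n : nat) : irreflexive (@cycle_rel n).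
Proof. by move=> i; rewrite /cycle_rel eqxx. Qed.

Definition cycle_graph (n : nat) : sgraph n :=
  SGraph (@cycle_rel_sym n) (@cycle_rel_irr n).

Definition SL (R : realType) (n : nat) (G : sgraph n) : set 'M[R]_n :=
  [set A | [/\ A^T = A,
               forall i j, G i j -> A i j < 0,
               forall i j, i != j -> ~~ G i j -> A i j = 0
             & forall i, A i i = - \sum_(k | k != i) A i k]]%classic.

Definition eigen_mult (R : realType) (n : nat) (A : 'M[R]_n) (x : R) : nat :=
  mup x (char_poly A).

(* Stated as a relation: the strictly increasing sequence [s] of all
   eigenvalues, hence the list [m], is uniquely determined by [A]. *)
Definition ordered_mult_list (R : realType) (n : nat) (A : 'M[R]_n)
    (m : seq nat) : Prop :=
  exists s : seq R,
    [/\ sorted <%R s,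
        forall x, (x \in s) = eigenvalue A x
      & m = [seq eigen_mult A x | x <- s]].

Definition SL_mult_lists (R : realType) (n : nat) (G : sgraph n) :
    set (seq nat) :=
  [set m | exists2 A : 'M[R]_n, SL G A & ordered_mult_list A m]%classic.

(* Main.v *)
Require Import Defs.
From mathcomp Require Import all_boot all_order all_algebra.
From mathcomp Require Import classical_sets reals.
From mathcomp Require Import ring lra.

(** The matrices in question are the Laplacians of the 4-cycle with positive
    edge weights [a], [b], [c], [d]. Such a matrix has characteristic polynomial
    [X * q] with [q] an explicit monic cubic and [q(0) < 0]. It suffices to show
    that [q] has real roots [0 < x <= y < z]: the eigenvalue 0 and the largest
    eigenvalue are then simple, and the list is (1,2,1) or (1,1,1,1) according
    as [x = y] or not. The weights (1,1,1,1) and (1,2,1,2) realize these cases.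

    The roots of [q] are found by sign changes, without the spectral theorem.
    Two points [0 < t < u] with [q(t) >= 0] and [q(u) < 0] are enough: they give
    a root at most [t] and one beyond [u], and the third one is real and between
    0 and [u] ([cubic_split]). For [u] the largest eigenvalue of the submatrix
    on three vertices works ([exists_between_top_eigenvalues]): interlacing puts
    it between the two largest eigenvalues, strictly because the Laplacian of
    a bipartite graph has, up to signs, a positive top eigenvector. For [t] the
    sum of the harmonic means of the two pairs of opposite weights works: it is
    the only possible value of a double eigenvalue, and [q(t)] is visibly
    nonnegative ([spectrum_cyc4_lap]). Finally [t <= (a + b + c + d) / 2], which
    is at most the larger of [a + b] and [c + d], hence below [u]. *)

Set Implicit Arguments.
Unset Strict Implicit.
Unset Printing Implicit Defensive.

Import Order.TTheory GRing.Theory Num.Theory.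
Local Open Scope ring_scope.

(** * Multiplicity lists of split characteristic polynomials *)

Lemma ordered_mult_list_prod (R : realType) n (A : 'M[R]_n) (l s : seq R) m :
    char_poly A = \prod_(x <- l) ('X - x%:P) -> sorted <%R s -> s =i l ->
  ordered_mult_list A m <-> m = [seq count_mem x l | x <- s].
Proof.
move=> pA s_sorted sl.
have eigl x : eigenvalue A x = (x \in l).
  by rewrite eigenvalue_root_char pA root_prod_XsubC.
have multE t : [seq eigen_mult A x | x <- t] = [seq count_mem x l | x <- t].
  by apply: eq_map => x; rewrite /eigen_mult pA mu_prod_XsubC.
split=> [[s' [s'_sorted s'E ->]]|->].
  rewrite multE; congr (map _ _); apply: lt_sorted_eq => // x.
  by rewrite s'E eigl sl.
exists s; split=> [||]; [by []|by move=> x; rewrite eigl sl|by rewrite multE].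
Qed.

(** * Weighted Laplacians of the 4-cycle *)

Local Notation v0 := (@Ordinal 4 0 isT).
Local Notation v1 := (@Ordinal 4 1 isT).
Local Notation v2 := (@Ordinal 4 2 isT).
Local Notation v3 := (@Ordinal 4 3 isT).

Lemma ord4P (P : 'I_4 -> Prop) : P v0 -> P v1 -> P v2 -> P v3 -> forall i, P i.
Proof.
by move=> P0 P1 P2 P3 [[|[|[|[|//]]]] lti]; rewrite (bool_irrelevance lti isT).
Qed.

Lemma big_ord4 (V : nmodType) (P : pred 'I_4) (F : 'I_4 -> V) :
  \sum_(k | P k) F k = \sum_(k <- [:: v0; v1; v2; v3] | P k) F k.
Proof.
rewrite big_mkcond !big_ord_recl big_ord0 [RHS]big_mkcond !big_cons big_nil.
by do !congr (_ + _); congr (if P _ then F _ else _); apply: val_inj.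
Qed.

(** The weights [a], [b], [c], [d] sit on the edges 01, 12, 23, 30 in this
    cyclic order, so [a], [c] and [b], [d] are the pairs of opposite edges. *)
Definition cyc4_lap (R : realType) (a b c d : R) : 'M[R]_4 :=
  \matrix_(i < 4, j < 4) nth 0 (nth [::] [::
    [:: a + d; - a; 0; - d];
    [:: - a; a + b; - b; 0];
    [:: 0; - b; b + c; - c];
    [:: - d; 0; - c; c + d]] i) j.

Lemma SL_cycle4P (R : realType) (A : 'M[R]_4) :
  SL (cycle_graph 4) A <->
  exists a b c d : R,
    [/\ 0 < a, 0 < b, 0 < c, 0 < d & A = cyc4_lap a b c d].
Proof.
split.
  case=> symA negA zeroA diagA.
  have sA i j : A i j = A j i by rewrite -{1}symA mxE.
  have A02 : A v0 v2 = 0 by apply: zeroA.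
  have A13 : A v1 v3 = 0 by apply: zeroA.
  exists (- A v0 v1), (- A v1 v2), (- A v2 v3), (- A v0 v3).
  split; rewrite ?oppr_gt0; try exact: negA.
  apply/matrixP => i j; rewrite mxE !opprK.
  have [->|] := eqVneq i j.
    rewrite diagA big_ord4.
    move: j; apply: ord4P; rewrite !big_cons big_nil /=
      ?(sA v1 v0) ?(sA v2 v0) ?(sA v2 v1) ?(sA v3) ?A02 ?A13;
    ring.
  move: i j; do 2!apply: ord4P => //=; move=> _;
    by rewrite // ?A02 ?A13 // sA ?A02 ?A13.
case=> a [b [c [d [a0 b0 c0 d0 ->]]]]; split.
- apply/matrixP => i j; rewrite !mxE.
  by move: i j; do 2!apply: ord4P.
- move=> i j; rewrite mxE; elim/ord4P: i; elim/ord4P: j => //= _;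
    by rewrite oppr_lt0.
- by move=> i j; rewrite mxE; move: i j; do 2!apply: ord4P.
- move=> i; rewrite big_ord4; move: i; apply: ord4P;
    rewrite !big_cons big_nil /= !mxE /=; ring.
Qed.

(** * The characteristic polynomial *)

Lemma det_mx22 (S : comPzRingType) (A : 'M[S]_2) :
  \det A = A ord0 ord0 * A ord_max ord_max - A ord0 ord_max * A ord_max ord0.
Proof.
rewrite (expand_det_row _ ord0) !big_ord_recl big_ord0 /cofactor !det_mx11 !mxE.
rewrite (_ : lift ord0 ord0 = ord_max); last exact: val_inj.
rewrite (_ : lift ord_max ord0 = ord0); last exact: val_inj.
rewrite /=; ring.
Qed.

Lemma det_mx33 (S : comPzRingType) (A : 'M[S]_3)
    (i0 := @Ordinal 3 0 isT) (i1 := @Ordinal 3 1 isT) (i2 := @Ordinal 3 2 isT) :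
  \det A =
    A i0 i0 * (A i1 i1 * A i2 i2 - A i1 i2 * A i2 i1)
  - A i0 i1 * (A i1 i0 * A i2 i2 - A i1 i2 * A i2 i0)
  + A i0 i2 * (A i1 i0 * A i2 i1 - A i1 i1 * A i2 i0).
Proof.
(* Entries indexed by natural numbers let the lifts of ordinals compute. *)
pose f i j := A (inord i) (inord j).
have fE (i j : 'I_3) : A i j = f i j by rewrite /f !inord_val.
rewrite (expand_det_row _ ord0) !big_ord_recl big_ord0 /cofactor !det_mx22 !mxE.
rewrite !fE /=; ring.
Qed.

(** By the all-minors matrix tree theorem the coefficients count spanning
    forests, each weighted by the product of its component sizes: two adjacent
    edges give components of sizes 3 and 1, two opposite edges give 2 and 2,
    and each of the four spanning trees counts 4 times. *)
Definition cyc4_cubic (R : realType) (a b c d : R) : {poly R} :=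
  'X^3 - (2 * (a + b + c + d))%:P * 'X^2
   + (3 * (a + c) * (b + d) + 4 * (a * c) + 4 * (b * d))%:P * 'X
   - (4 * (a * c * (b + d) + b * d * (a + c)))%:P.

Lemma char_poly_cyc4_lap (R : realType) (a b c d : R) :
  char_poly (cyc4_lap a b c d) = 'X * cyc4_cubic a b c d.
Proof.
(* The entries of X - A as explicit lists, so that minors of minors reduce by
   computation instead of by case analysis on ordinals. *)
pose f i j : {poly R} := (nth 0 (nth [::] [::
    [:: 'X - (a + d)%:P; a%:P; 0; d%:P];
    [:: a%:P; 'X - (a + b)%:P; b%:P; 0];
    [:: 0; b%:P; 'X - (b + c)%:P; c%:P];
    [:: d%:P; 0; c%:P; 'X - (c + d)%:P]] i) j).
have -> : char_poly (cyc4_lap a b c d) = \det (\matrix_(i < 4, j < 4) f i j).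
  congr (\det _); apply/matrixP => i j; rewrite !mxE /f.
  by move: i j; do 2!apply: ord4P => /=;
    rewrite ?mulr1n ?mulr0n ?sub0r ?polyCN ?opprK ?subr0 ?oppr0.
rewrite (expand_det_row _ ord0) !big_ord_recl big_ord0 /cofactor.
rewrite !det_mx33 !mxE /f /cyc4_cubic /=.
ring.
Qed.

(** * Locating the eigenvalues *)

(** The sign pattern gives a positive root at most [t] and a root beyond [u];
    the third one is then real because the remaining factor is linear, and the
    signs at 0 and [u] place it between these points. A sign change between [t]
    and [u] would miss it when [t] itself is a double root. *)
Lemma cubic_split (R : realType) (p : {poly R}) (t u v : R) :
    size p = 4 -> p \is monic -> 0 < t -> t < u -> u < v ->
    p.[0] < 0 -> 0 <= p.[t] -> p.[u] < 0 -> 0 <= p.[v] ->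
  exists x y z : R, [/\ 0 < x, x <= y, y < z &
    p = \prod_(w <- [:: x; y; z]) ('X - w%:P)].
Proof.
move=> p4 p_monic t0 tu uv p0 pt pu pv.
have [x /andP[x0 xt] rx] : exists2 x, 0 <= x <= t & root p x.
  by apply: poly_ivt; rewrite ?pt ltW.
have [z /andP[uz zv] rz] : exists2 x, u <= x <= v & root p x.
  by apply: poly_ivt; rewrite ?pv ltW.
have xz : x < z by lra.
have [||r pE] := @uniq_roots_prod_XsubC _ p [:: x; z].
- by rewrite /= rx rz.
- by rewrite uniq_rootsE /= inE lt_eqF.
have [y rE] : exists y, r = 'X - y%:P.
  have q_monic := monic_prod_XsubC [:: x; z] xpredT id.
  have r_monic : r \is monic by rewrite -(monicMr r q_monic) -pE.
  have r2 : size r = 2.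
    apply/eqP; rewrite -(eqn_add2r 2) -[X in _ == X]p4 pE.
    by rewrite size_Mmonic ?monic_neq0 // size_prod_XsubC addn3 addn2.
  exists (- r`_0); apply/polyP => -[|[|i]]; rewrite coefB coefX coefC /=.
  - by rewrite sub0r opprK.
  - by move/monicP: r_monic; rewrite lead_coefE r2 subr0.
  - by rewrite nth_default ?r2 // subr0.
have {rE} pE : p = ('X - x%:P) * (('X - y%:P) * ('X - z%:P)).
  rewrite pE rE !big_cons big_nil; ring.
have pw w : p.[w] = (w - x) * ((w - y) * (w - z)) by rewrite pE !hornerE.
(* [u] and [0] are not roots, so the bounds of the intermediate value theorem
   become strict. *)
have {}uz : u < z.
  rewrite lt_neqAle uz andbT; apply: contraTneq pu => ->.
  by rewrite pw subrr !mulr0 ltxx.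
have {}x0 : 0 < x.
  rewrite lt_neqAle x0 andbT; apply: contraTneq p0 => x_0.
  by rewrite pw {1}x_0 subrr mul0r ltxx.
have yu : y < u.
  move: pu; rewrite pw pmulr_rlt0 ?subr_gt0 ?(le_lt_trans xt) //.
  by rewrite nmulr_llt0 ?subr_lt0 // subr_gt0.
have y0 : 0 < y.
  move: p0; rewrite pw !sub0r nmulr_rlt0 ?oppr_lt0 //.
  by rewrite nmulr_lgt0 ?oppr_lt0 // (lt_trans x0 xz).
(* Nothing orders the roots [x] and [y] below [u] yet. *)
have [xy|/ltW yx] := leP x y.
  exists x, y, z; split=> //; first lra; by rewrite pE !big_cons big_nil mulr1.
exists y, x, z; split=> //; rewrite pE !big_cons big_nil mulr1; ring.
Qed.

(** The equation says that [u] is an eigenvalue of the principal submatrix on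
    the vertices 1, 2, 3, namely its largest one, since it exceeds the diagonal
    entries at both ends of the path 1-2-3. By Cauchy interlacing this
    eigenvalue lies between the two largest eigenvalues of the Laplacian. *)
Lemma exists_between_top_eigenvalues (R : realType) (a b c d : R) :
    0 < a -> 0 < b -> 0 < c -> 0 < d ->
  exists u, [/\ a + b < u, c + d < u, u <= 3 * (a + b + c + d) &
    (u - b - c) * (u - a - b) * (u - c - d) =
    b ^+ 2 * (u - c - d) + c ^+ 2 * (u - a - b)].
Proof.
move=> a0 b0 c0 d0.
(* Reflecting the cycle through vertices 0 and 2 swaps [a], [d] and [b], [c]. *)
wlog cd_le : a b c d a0 b0 c0 d0 / c + d <= a + b.
  move=> W; have [|/ltW] := leP (c + d) (a + b); first exact: W.
  rewrite (addrC a) (addrC c) => /(W d c b a d0 c0 b0 a0)[u [h1 h2 h3 h4]].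
  by exists u; split; lra.
pose r : {poly R} := ('X - (b + c)%:P) * ('X - (a + b)%:P) * ('X - (c + d)%:P)
  - (b ^+ 2)%:P * ('X - (c + d)%:P) - (c ^+ 2)%:P * ('X - (a + b)%:P).
have rE x : r.[x] = (x - (b + c)) * (x - (a + b)) * (x - (c + d))
    - b ^+ 2 * (x - (c + d)) - c ^+ 2 * (x - (a + b)).
  by rewrite !hornerE.
(* The polynomial [r] can vanish at [a + b] (when [a + b = c + d]), so the
   search starts slightly above: [e] satisfies [e * (e + a - c) <= b ^+ 2],
   which makes [r] nonpositive at [a + b + e]. *)
pose e := b ^+ 2 / (a + b).
have e0 : 0 < e by rewrite divr_gt0 ?exprn_gt0 ?addr_gt0.
have eE : e * (a + b) = b ^+ 2 by rewrite /e; field; lra.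
have eb : e < b by nra.
have [u /andP[u1 u2] ru] :
    exists2 u, a + b + e <= u <= 3 * (a + b + c + d) & root r u.
  apply: poly_ivt; first lra.
  rewrite !rE; apply/andP; split.
    have Z0 : 0 < a + b + e - (c + d) by lra.
    have YX : (a + b + e - (b + c)) * (a + b + e - (a + b)) <= b ^+ 2 by nra.
    have := ler_wpM2r (ltW Z0) YX; nra.
  set w := 3 * (a + b + c + d).
  have X0 : 0 < w - (a + b) by rewrite /w; lra.
  have Z0 : 0 < w - (c + d) by rewrite /w; lra.
  have YX : 2 * b ^+ 2 <= (w - (b + c)) * (w - (a + b)) by rewrite /w; nra.
  have YZ : 2 * c ^+ 2 <= (w - (b + c)) * (w - (c + d)) by rewrite /w; nra.
  have := ler_wpM2r (ltW Z0) YX; have := ler_wpM2r (ltW X0) YZ; nra.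
exists u; split=> //; try lra.
move: ru; rewrite /root rE => /eqP; lra.
Qed.

(** The point [t = 2ac/(a+c) + 2bd/(b+d)] separates the two smaller nonzero
    eigenvalues: a double nonzero eigenvalue makes all 3 x 3 minors of
    [A - t] vanish, and already the minors omitting the row of one vertex and
    the column of the opposite one force this value of [t]. The cubic [q] is
    nonnegative there since, with [al] and [be] for the two summands,
    [q(t) = t * ((a + c - 2al)(b + d - 2be) + (al - be)^2)],
    and [al <= (a+c)/2], [be <= (b+d)/2] by the inequality between harmonic
    and arithmetic means. *)
Lemma spectrum_cyc4_lap (R : realType) (a b c d : R) :
    0 < a -> 0 < b -> 0 < c -> 0 < d ->
  exists x y z : R, [/\ 0 < x, x <= y, y < z &
    char_poly (cyc4_lap a b c d) = \prod_(w <- [:: 0; x; y; z]) ('X - w%:P)].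
Proof.
move=> a0 b0 c0 d0.
rewrite char_poly_cyc4_lap.
set q := cyc4_cubic a b c d.
have qE x : q.[x] = x ^+ 3 - 2 * (a + b + c + d) * x ^+ 2
   + (3 * (a + c) * (b + d) + 4 * (a * c) + 4 * (b * d)) * x
   - 4 * (a * c * (b + d) + b * d * (a + c)).
  by rewrite /q /cyc4_cubic !hornerE.
have [q4 q_monic] : size q = 4 /\ q \is monic.
  rewrite /q /cyc4_cubic -!addrA.
  set r := (X in 'X^3 + X).
  have r3 : (size r < size ('X^3 : {poly R}))%N.
    rewrite size_polyXn ltnS; apply/leq_sizeP => j j3.
    rewrite /r !coefD !coefN !coefCM coefXn coefX coefC.
    by case: j j3 => [|[|[|j]]] //= _; rewrite !mulr0 oppr0 !addr0.
  by rewrite size_polyDl // size_polyXn monicE lead_coefDl // lead_coefXn.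
have [u [Xu Zu u_le uE]] := exists_between_top_eigenvalues a0 b0 c0 d0.
pose al := 2 * (a * c) / (a + c); pose be := 2 * (b * d) / (b + d).
have alE : al * (a + c) = 2 * (a * c) by rewrite /al; field; lra.
have beE : be * (b + d) = 2 * (b * d) by rewrite /be; field; lra.
have al0 : 0 < al by rewrite divr_gt0 ?mulr_gt0 ?addr_gt0.
have be0 : 0 < be by rewrite divr_gt0 ?mulr_gt0 ?addr_gt0.
have al_le : 2 * al <= a + c.
  by rewrite -(ler_pM2r (addr_gt0 a0 c0)); have := sqr_ge0 (a - c); nra.
have be_le : 2 * be <= b + d.
  by rewrite -(ler_pM2r (addr_gt0 b0 d0)); have := sqr_ge0 (b - d); nra.
have [|||||||x [y [z [x0 xy yz qxyz]]]] :=
  @cubic_split R q (al + be) u (4 * (a + b + c + d)) q4 q_monic.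
- lra.
- lra.
- lra.
- rewrite qE; have := mulr_gt0 a0 c0; have := mulr_gt0 b0 d0; nra.
- suff -> : q.[al + be] = (al + be) *
     ((a + c - 2 * al) * (b + d - 2 * be) + (al - be) ^+ 2).
    rewrite mulr_ge0 ?(ltW (addr_gt0 al0 be0)) // addr_ge0 ?sqr_ge0 //.
    by rewrite mulr_ge0 // subr_ge0.
  have acE : a * c = al * (a + c) / 2 by rewrite alE; field.
  have bdE : b * d = be * (b + d) / 2 by rewrite beE; field.
  by rewrite qE acE bdE; field.
- have u0 : 0 < u by lra.
  pose X := u - a - b; pose Z := u - c - d.
  have X0 : 0 < X by rewrite /X; lra.
  have Z0 : 0 < Z by rewrite /Z; lra.
  (* Expand det(u - A) along vertex 0. As [u] is an eigenvalue of the remaining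
     block, the adjugate of that block has rank one and the expansion is minus
     a square, up to the factor [X * Z]. *)
  have uq : u * q.[u] * (X * Z) = - (a * b * Z + c * d * X) ^+ 2.
    pose r := (u - b - c) * X * Z - (b ^+ 2 * Z + c ^+ 2 * X).
    have r0 : r = 0 by rewrite /r /X /Z uE subrr.
    transitivity (r * ((u - a - d) * X * Z - a ^+ 2 * Z - d ^+ 2 * X)
                  - (a * b * Z + c * d * X) ^+ 2).
      rewrite qE /r /X /Z; ring.
    by rewrite r0 mul0r sub0r.
  rewrite -(pmulr_rlt0 _ u0) -(pmulr_llt0 _ (mulr_gt0 X0 Z0)) uq.
  by rewrite oppr_lt0 exprn_gt0 // addr_gt0 // !mulr_gt0.
- have -> : q.[4 * (a + b + c + d)] = 32 * (a + b + c + d) ^+ 3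
      + 12 * ((a + b + c + d) * (a + c) * (b + d))
      + 16 * (a * c * (a + c) + b * d * (b + d))
      + 12 * (a * c * (b + d) + b * d * (a + c)).
    by rewrite qE; ring.
  have [a1 b1 c1 d1] : [/\ 0 <= a, 0 <= b, 0 <= c & 0 <= d].
    by split; exact: ltW.
  by do !rewrite ?exprn_ge0 ?ler0n // ?addr_ge0 ?mulr_ge0.
exists x, y, z; split=> //.
by rewrite qxyz [RHS]big_cons polyC0 subr0.
Qed.

Lemma ordered_mult_list_of_spectrum (R : realType) (A : 'M[R]_4) (x y z : R) m :
    0 < x -> x <= y -> y < z ->
    char_poly A = \prod_(w <- [:: 0; x; y; z]) ('X - w%:P) ->
  ordered_mult_list A m <->
  m = if x == y then [:: 1; 2; 1]%N else [:: 1; 1; 1; 1]%N.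
Proof.
move=> x0 xy yz pA; have xz := le_lt_trans xy yz; have z0 := lt_trans x0 xz.
have [xy_eq|xy_neq] := eqVneq x y.
  subst y; rewrite (ordered_mult_list_prod m (s := [:: 0; x; z]) pA).
  - by rewrite /= !eqxx !(gt_eqF x0, lt_eqF x0, gt_eqF z0, lt_eqF z0,
      gt_eqF xz, lt_eqF xz).
  - by rewrite /= x0 yz.
  - by move=> w; rewrite !inE; do !case: eqP.
have {xy_neq} xy : x < y by rewrite lt_neqAle xy_neq.
rewrite (ordered_mult_list_prod m (s := [:: 0; x; y; z]) pA) //=; last first.
  by rewrite x0 xy yz.
have y0 := lt_trans x0 xy.
by rewrite !eqxx !(gt_eqF x0, lt_eqF x0, gt_eqF y0, lt_eqF y0, gt_eqF z0,
  lt_eqF z0, gt_eqF xy, lt_eqF xy, gt_eqF yz, lt_eqF yz, gt_eqF xz, lt_eqF xz).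
Qed.

(** * The attained lists *)

Theorem theorem3p7 (R : realType) :
  SL_mult_lists R (cycle_graph 4)
  = [set [:: 1; 1; 1; 1]%N; [:: 1; 2; 1]%N]%classic.
Proof.
apply/seteqP; split=> m /=.
  case=> A /SL_cycle4P[a [b [c [d [a0 b0 c0 d0 ->]]]]].
  have [x [y [z [x0 xy yz pA]]]] := spectrum_cyc4_lap a0 b0 c0 d0.
  rewrite (ordered_mult_list_of_spectrum m x0 xy yz pA).
  by case: eqP => _ ->; [right|left].
case=> ->.
  (* Spectrum 0, 2, 4, 6. *)
  exists (cyc4_lap 1 2 1 2).
    by apply/SL_cycle4P; exists 1, 2, 1, 2; split; rewrite ?ltr0n.
  apply/(@ordered_mult_list_of_spectrum _ _ 2 4 6);
    rewrite ?ltr_nat ?ler_nat //.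
    rewrite char_poly_cyc4_lap /cyc4_cubic !big_cons big_nil; ring.
  by rewrite eqr_nat.
(* Spectrum 0, 2, 2, 4. *)
exists (cyc4_lap 1 1 1 1).
  by apply/SL_cycle4P; exists 1, 1, 1, 1; split; rewrite ?ltr0n.
apply/(@ordered_mult_list_of_spectrum _ _ 2 2 4); rewrite ?ltr_nat ?ler_nat //.
  rewrite char_poly_cyc4_lap /cyc4_cubic !big_cons big_nil; ring.
by rewrite eqxx.
Qed.
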